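(* For any positive real number $x$ and any positive integer $m$, the following three formulas hold: $$\sum_{j=0}^{2m-1}\frac{1}{x^{2}+\sin^{2}\frac{j\pi}{2m}}=\frac{(2m-1)F_{2m+1}(2x)+(2m+1)F_{2m-1}(2x)}{2x(x^{2}+1)F_{2m}(2x)}+\frac{1}{x^{2}+1},$$ $$\sum_{j=0}^{2m-1}\frac{1}{x^{2}+4\sin^{2}\frac{j\pi}{2m}}=\frac{2mL_{2m}(x)-xF_{2m}(x)}{x(x^{2}+4)F_{2m}(x)}+\frac{1}{x^{2}+4},$$ $$\sum_{j=0}^{2m-1}\frac{1}{x^{2}+\sin^{2}\frac{j\pi}{2m}}=\frac{mQ_{2m}(x)-xP_{2m}(x)}{x(x^{2}+1)P_{2m}(x)}+\frac{1}{x^{2}+1}.$$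
   Context: The Fibonacci polynomials are defined by $F_0(x)=0$, $F_1(x)=1$, $F_n(x)=xF_{n-1}(x)+F_{n-2}(x)$ for $n\ge 2$. The Lucas polynomials are defined by $L_0(x)=2$, $L_1(x)=x$, $L_n(x)=xL_{n-1}(x)+L_{n-2}(x)$ for $n\ge 2$. The Pell polynomials are $P_n(x)=F_n(2x)$ and the Pell-Lucas polynomials are $Q_n(x)=L_n(2x)$. *)

(* Defs.v *)
From HB Require Import structures.
From mathcomp Require Import all_boot all_order all_algebra.
From mathcomp Require Import all_classical all_reals all_analysis.

Set Implicit Arguments.
Unset Strict Implicit.
Unset Printing Implicit Defensive.

Import Order.TTheory GRing.Theory Num.Theory.

Local Open Scope ring_scope.

Fixpoint fib_poly (R : comNzRingType) (n : nat) : {poly R} :=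
  match n with
  | 0 => 0
  | n1.+1 => match n1 with
             | 0 => 1
             | n2.+1 => 'X * fib_poly R n1 + fib_poly R n2
             end
  end.

Fixpoint lucas_poly (R : comNzRingType) (n : nat) : {poly R} :=
  match n with
  | 0 => 2%:R
  | n1.+1 => match n1 with
             | 0 => 'X
             | n2.+1 => 'X * lucas_poly R n1 + lucas_poly R n2
             end
  end.

Definition pell_poly (R : comNzRingType) (n : nat) : {poly R} :=
  fib_poly R n \Po (2%:R *: 'X).

Definition pell_lucas_poly (R : comNzRingType) (n : nat) : {poly R} :=
  lucas_poly R n \Po (2%:R *: 'X).

(* Main.v *)
(** With [a + b = x] and [a * b = -1], each summand is
    [1 / (r + r^-1 - 2 cos t)] with [r = a ^ 2] and [t = 2 j pi / N], a value
    of the [N]-periodized Poisson kernel: up to a factor independent of [j] it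
    equals the cosine sum of the [(r ^ k + r ^ (N - k)) cos (k t)], [k < N].
    Summing over [j] kills every frequency but [k = 0], and Binet's formulas
    express what remains in terms of Fibonacci and Lucas polynomials. *)
Require Import Defs.
From HB Require Import structures.
From mathcomp Require Import all_boot all_order all_algebra.
From mathcomp Require Import all_classical all_reals all_analysis.
From mathcomp Require Import ring lra.

Import Order.TTheory GRing.Theory Num.Theory.

Local Open Scope ring_scope.

Lemma fib_polySS (R : comNzRingType) n :
  fib_poly R n.+2 = 'X * fib_poly R n.+1 + fib_poly R n.
Proof. by []. Qed.

Lemma lucas_polySS (R : comNzRingType) n :
  lucas_poly R n.+2 = 'X * lucas_poly R n.+1 + lucas_poly R n.
Proof. by []. Qed.

(** Serves only the first formula, which is stated without Lucas polynomials. The recurrence has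
    order two, so the induction carries two consecutive indices. *)
Lemma lucas_poly_fib (R : comNzRingType) n :
  lucas_poly R n.+1 = fib_poly R n.+2 + fib_poly R n.
Proof.
suff [] : lucas_poly R n.+1 = fib_poly R n.+2 + fib_poly R n /\
  lucas_poly R n.+2 = fib_poly R n.+3 + fib_poly R n.+1 by [].
elim: n => [|n [IH1 IH2]]; first by split=> /=; ring.
split=> //; rewrite lucas_polySS IH1 IH2 (fib_polySS _ n.+2) (fib_polySS _ n).
by ring.
Qed.

Section Binet.
Variables (R : comNzRingType) (a b : R).
Hypothesis ab : a * b = -1.

(** [a] and [b] are the roots of [T ^ 2 - (a + b) T - 1], so their powers obey the recurrence. The
    factor [a - b] stays on the left because [R] need not have inverses. *)
Lemma fib_poly_binet n :
  (a - b) * (fib_poly R n).[a + b] = a ^+ n - b ^+ n.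
Proof.
suff [] : (a - b) * (fib_poly R n).[a + b] = a ^+ n - b ^+ n /\
  (a - b) * (fib_poly R n.+1).[a + b] = a ^+ n.+1 - b ^+ n.+1 by [].
elim: n => [|n [IH1 IH2]]; first by split; rewrite hornerE; ring.
split=> //; rewrite fib_polySS !hornerE mulrDr IH1 mulrCA IH2 !exprS.
by ring: ab.
Qed.

Lemma lucas_poly_binet n : (lucas_poly R n).[a + b] = a ^+ n + b ^+ n.
Proof.
suff [] : (lucas_poly R n).[a + b] = a ^+ n + b ^+ n /\
  (lucas_poly R n.+1).[a + b] = a ^+ n.+1 + b ^+ n.+1 by [].
elim: n => [|n [IH1 IH2]]; first by split; rewrite !hornerE; ring.
split=> //; rewrite lucas_polySS !hornerE IH1 IH2 !exprS.
by ring: ab.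
Qed.

End Binet.

(** Real part of the geometric sum of [z = r e^(it)], cleared of its denominator: the first factor
    is [|1 - z|^2 / r]. *)
Lemma sum_geom_cos (R : realType) (r t : R) n : r != 0 ->
  (r + r^-1 - 2 * cos t) * \sum_(k < n) r ^+ k * cos (k%:R * t)
  = r ^+ n * (cos (n%:R * t) * cos t + sin (n%:R * t) * sin t
              - r^-1 * cos (n%:R * t)) - (cos t - r^-1).
Proof.
move=> r0; elim: n => [|n IH].
  by rewrite big_ord0 mul0r cos0 sin0; ring.
rewrite big_ord_recr /= mulrDr IH exprS.
have -> : n.+1%:R * t = n%:R * t + t by rewrite -natr1 mulrDl mul1r.
rewrite cosD sinD.
have -> : r ^+ n = r * (r^-1 * r ^+ n) by rewrite mulVKf.
have cs : sin t ^+ 2 = 1 - cos t ^+ 2 by rewrite -(cos2Dsin2 t) addrC addKr.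
by field: cs.
Qed.

Lemma sum_cos_natmul_eq0 (R : realType) N k : (0 < k < N)%N ->
  \sum_(j < N) cos (k%:R * (j%:R * (2 * pi) / N%:R)) = 0 :> R.
Proof.
case/andP=> k0 kN.
have N0 : (N%:R : R) != 0 by rewrite pnatr_eq0 -lt0n (ltn_trans k0).
set a : R := k%:R * pi / N%:R.
have sa : sin a != 0.
  rewrite gt_eqF// sin_gt0_pi// /a divr_gt0 ?mulr_gt0 ?pi_gt0 ?ltr0n//=;
    last by apply: ltn_trans kN.
  rewrite ltr_pdivrMr ?ltr0n ?(ltn_trans k0)// mulrC ltr_pM2l ?pi_gt0//.
  by rewrite ltr_nat.
have aE j : k%:R * (j%:R * (2 * pi) / N%:R) = j%:R * a *+ 2.
  by rewrite /a; field.
apply: (mulfI sa); rewrite mulr0.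
(* Telescoping: [2 sin a cos (2ja) = sin ((2j + 1) a) - sin ((2j - 1) a)]. *)
have tele n : 2 * (sin a * \sum_(j < n) cos (j%:R * a *+ 2))
            = sin (n%:R * a *+ 2 - a) + sin a.
  elim: n => [|n IH].
    by rewrite big_ord0 mulr0 mul0r mul0rn sub0r sinN addNr mulr0.
  rewrite big_ord_recr /= 2!mulrDr IH.
  have -> : n.+1%:R * a *+ 2 - a = n%:R * a *+ 2 + a by rewrite -natr1; ring.
  by move: (n%:R * a *+ 2) => A; rewrite sinB sinD; ring.
under eq_bigr do rewrite aE.
apply: (@mulfI _ 2); rewrite ?pnatr_eq0// tele mulr0.
(* The two end terms cancel, since [2Na] is [k] full turns. *)
have -> : N%:R * a *+ 2 - a = - a + pi *+ 2 *+ k.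
  by rewrite /a; field.
by rewrite (periodicn (@sinD2pi R)) sinN addNr.
Qed.

(** The geometric sums for [r] and [r^-1], weighted by [1] and [r ^ N], have boundary terms
    [(r ^ N - 1) (cos t - r^-1)] and [(1 - r ^ N) (cos t - r)]; adding them eliminates [cos t]. *)
Lemma inv_poisson_kernel (R : realType) (r t : R) N :
  1 < r -> (0 < N)%N -> cos (N%:R * t) = 1 -> sin (N%:R * t) = 0 ->
  (r + r^-1 - 2 * cos t)^-1
  = (\sum_(k < N) (r ^+ k + r ^+ N * r^-1 ^+ k) * cos (k%:R * t))
    / ((r - r^-1) * (r ^+ N - 1)).
Proof.
move=> r1 N0 cN sN; have r_gt0 : 0 < r := lt_trans ltr01 r1.
have r0 : r != 0 by rewrite gt_eqF.
have rN : r ^+ N - 1 != 0 by rewrite subr_eq0 gt_eqF// exprn_egt1// -lt0n.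
have rV1 : r^-1 < 1 by rewrite invf_lt1.
have rr : r * r - 1 != 0 by rewrite gt_eqF//; nra.
have D0 : r + r^-1 - 2 * cos t != 0.
  have rV : r * r^-1 = 1 by rewrite divff.
  (* This product is [r + r^-1 - 2], a lower bound for the denominator. *)
  have := cos_le1 t; have : 0 < (r - 1) * (1 - r^-1).
    by rewrite mulr_gt0 ?subr_gt0.
  by move=> p c; rewrite gt_eqF//; nra.
apply: (mulfI D0); rewrite divff// mulrA.
under eq_bigr do rewrite mulrDl -mulrA.
rewrite big_split /= -mulr_sumr.
have S1 := @sum_geom_cos R r t N r0.
have := @sum_geom_cos R r^-1 t N; rewrite invr_eq0 => /(_ r0).
rewrite invrK [r^-1 + r]addrC => S2.
rewrite mulrDr S1 mulrCA S2 cN sN exprVn.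
by field; rewrite r0 rN rr expf_neq0.
Qed.

Lemma sum_inv_poisson_kernel (R : realType) (r : R) N : 1 < r -> (0 < N)%N ->
  \sum_(j < N) (r + r^-1 - 2 * cos (j%:R * (2 * pi) / N%:R))^-1
  = N%:R * (r ^+ N + 1) / ((r - r^-1) * (r ^+ N - 1)).
Proof.
move=> r1 N0; have N0R : (N%:R : R) != 0 by rewrite pnatr_eq0 -lt0n.
under eq_bigr => j _.
  have tE : N%:R * (j%:R * (2 * pi) / N%:R) = 0 + pi *+ 2 *+ j :> R by field.
  rewrite (@inv_poisson_kernel _ _ _ N) ?tE ?(periodicn (@cosD2pi R)) ?cos0
    ?(periodicn (@sinD2pi R)) ?sin0//.
  over.
rewrite -mulr_suml exchange_big /=; congr (_ / _).
case: N N0 {N0R} => // N _.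
rewrite big_ord_recl [X in _ + X]big1 => [|k _]; last first.
  by rewrite -mulr_sumr sum_cos_natmul_eq0 ?mulr0// /bump /= ltnS.
under eq_bigr do rewrite mul0r cos0 mulr1.
by rewrite sumr_const card_ord addr0 !expr0 mulr1 -[LHS]mulr_natl addrC.
Qed.

Lemma sum_inv_sin (R : realType) (x : R) N : 0 < x -> (0 < N)%N -> ~~ odd N ->
  (fib_poly R N).[x] != 0 /\
  \sum_(0 <= j < N) (x ^+ 2 + 4 * sin (j%:R * pi / N%:R) ^+ 2)^-1
  = N%:R * (lucas_poly R N).[x] / (x * (x ^+ 2 + 4) * (fib_poly R N).[x]).
Proof.
move=> x0 N0 Nev.
set d := Num.sqrt (x ^+ 2 + 4).
have d2 : d ^+ 2 = x ^+ 2 + 4 by rewrite sqr_sqrtr//; nra.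
have d0 : 0 < d by rewrite sqrtr_gt0; nra.
(* The roots of [T ^ 2 - x T - 1]. Evenness of [N] then gives [b ^ N = (a ^ N)^-1], with no sign. *)
set a := (x + d) / 2; set b := (x - d) / 2.
have ab : a * b = -1 by rewrite /a /b; field: d2.
have xE : x = a + b by rewrite /a /b; field.
have dE : d = a - b by rewrite /a /b; field.
have a1 : 1 < a by rewrite /a; nra.
have a0 : a != 0 by rewrite gt_eqF// (lt_trans ltr01).
have bE : b = - a^-1 by apply: (mulfI a0); rewrite ab mulrN divff.
have r1 : 1 < a ^+ 2 by rewrite exprn_egt1.
have bN : b ^+ N = (a ^+ N)^-1.
  by rewrite bE exprNn -signr_odd (negbTE Nev) mul1r exprVn.
have u1 : 1 < a ^+ N by rewrite exprn_egt1// -lt0n.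
have FE : d * (fib_poly R N).[x] = a ^+ N - (a ^+ N)^-1.
  by rewrite dE xE fib_poly_binet// bN.
have LE : (lucas_poly R N).[x] = a ^+ N + (a ^+ N)^-1.
  by rewrite xE lucas_poly_binet// bN.
have u0 : a ^+ N != 0 by rewrite gt_eqF// (lt_trans ltr01).
have uu : a ^+ N * a ^+ N - 1 != 0 by rewrite gt_eqF//; nra.
have F0 : (fib_poly R N).[x] != 0.
  apply/eqP => F0; move: FE; rewrite F0 mulr0 => /eqP.
  rewrite eq_sym subr_eq0 => /eqP e.
  by move: uu; rewrite {1}e mulVf// subrr eqxx.
split=> //; rewrite big_mkord.
under eq_bigr => j _.
  have -> : x ^+ 2 + 4 * sin (j%:R * pi / N%:R) ^+ 2
    = a ^+ 2 + (a ^+ 2)^-1 - 2 * cos (j%:R * (2 * pi) / N%:R).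
    have -> : j%:R * (2 * pi) / N%:R = (j%:R * pi / N%:R) *+ 2 :> R by ring.
    rewrite cos_mulr2n; set t := _ / _.
    have -> : cos t ^+ 2 = 1 - sin t ^+ 2 by rewrite -(cos2Dsin2 t) addrK.
    by rewrite xE bE; field.
  over.
rewrite sum_inv_poisson_kernel// LE -d2.
have -> : a ^+ 2 - (a ^+ 2)^-1 = x * d by rewrite xE dE bE; field.
(* What remains is [(u ^ 2 + 1) / (u ^ 2 - 1) = (u + u^-1) / (u - u^-1)], the Lucas value over [d]
   times the Fibonacci value; the second [d] comes from [x * d]. *)
rewrite [(a ^+ 2) ^+ N]exprAC; set u := a ^+ N in u1 u0 uu FE *.
have x0' : x != 0 by rewrite gt_eqF.
have d0' : d != 0 by rewrite gt_eqF.
have -> : (fib_poly R N).[x] = (u - u^-1) / d by rewrite -FE mulrC mulKf.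
by field; rewrite x0' d0' u0 uu.
Qed.

Theorem corollary5p1 (R : realType) (x : R) (hx : 0 < x) (m : nat)
    (hm : (0 < m)%N) :
  [/\ \sum_(0 <= j < 2 * m) (x ^+ 2 + sin (j%:R * pi / (2 * m%:R)) ^+ 2)^-1
      = ((2 * m%:R - 1) * (fib_poly R (2 * m + 1)).[2 * x]
         + (2 * m%:R + 1) * (fib_poly R (2 * m - 1)).[2 * x])
        / (2 * x * (x ^+ 2 + 1) * (fib_poly R (2 * m)).[2 * x])
        + (x ^+ 2 + 1)^-1,
      \sum_(0 <= j < 2 * m) (x ^+ 2 + 4 * sin (j%:R * pi / (2 * m%:R)) ^+ 2)^-1
      = (2 * m%:R * (lucas_poly R (2 * m)).[x] - x * (fib_poly R (2 * m)).[x])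
        / (x * (x ^+ 2 + 4) * (fib_poly R (2 * m)).[x])
        + (x ^+ 2 + 4)^-1
    & \sum_(0 <= j < 2 * m) (x ^+ 2 + sin (j%:R * pi / (2 * m%:R)) ^+ 2)^-1
      = (m%:R * (pell_lucas_poly R (2 * m)).[x]
         - x * (pell_poly R (2 * m)).[x])
        / (x * (x ^+ 2 + 1) * (pell_poly R (2 * m)).[x])
        + (x ^+ 2 + 1)^-1].
Proof.
have N0 : (0 < 2 * m)%N by rewrite muln_gt0.
have Nev : ~~ odd (2 * m) by rewrite mul2n odd_double.
have x0 : x != 0 by rewrite gt_eqF.
have x1 : x ^+ 2 + 1 != 0 by rewrite gt_eqF//; nra.
have x4 : x ^+ 2 + 4 != 0 by rewrite gt_eqF//; nra.
have [F0 S1] := @sum_inv_sin R x _ hx N0 Nev.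
have [F0' S2] := @sum_inv_sin R (2 * x) _ (mulr_gt0 (ltr0Sn _ 1) hx) N0 Nev.
have S3 : \sum_(0 <= j < 2 * m) (x ^+ 2 + sin (j%:R * pi / (2 * m%:R)) ^+ 2)^-1
    = m%:R * (lucas_poly R (2 * m)).[2 * x]
      / (x * (x ^+ 2 + 1) * (fib_poly R (2 * m)).[2 * x]).
  (* Replacing [x] by [2 * x] in [sum_inv_sin] multiplies each denominator by 4. *)
  transitivity (4 * (\sum_(0 <= j < 2 * m)
      ((2 * x) ^+ 2 + 4 * sin (j%:R * pi / (2 * m)%:R) ^+ 2)^-1)).
    rewrite mulr_sumr; apply: eq_bigr => j _; rewrite natrM.
    set s := sin _.
    have p : x ^+ 2 + s ^+ 2 != 0 by rewrite gt_eqF//; nra.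
    by field; rewrite p gt_eqF//; nra.
  rewrite S2 natrM; field.
  by rewrite F0' x0 x1 gt_eqF//; nra.
split.
- rewrite S3.
  (* Writing [2 * m] as [n.+1] resolves the truncated subtraction. The isolated fraction is absorbed
     through [F_(n+2) - F_n = 2x F_(n+1)], at the point [2 * x]. *)
  move: F0'; case: (2 * m)%N N0 => // n _ F0'.
  rewrite addn1 subn1 succnK lucas_poly_fib fib_polySS !hornerE.
  by field; rewrite F0' x0 x1.
- rewrite -natrM S1 natrM; field.
  by rewrite F0 x0 x4.
- rewrite S3 /pell_lucas_poly /pell_poly !horner_comp !hornerE.
  by field; rewrite F0' x0 x1.
Qed.
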